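(* Let $\emptyset\ne T\subseteq[n-1]$. For $\omega\in S_n$ let $\rho_\omega$ be the fundamental cycle of $\overline\Pi_\omega$. Then the set $\{\rho_\omega:\omega\in S_n,\ \omega(n)=n$ and $\omega(n-1)\in T\}$ forms a basis for $\widetilde H_{n-3}(\overline{\Pi_n(T)};\mathbb{Z})$.
   Context: $\Pi_n$ is the lattice of set partitions of $[n]$ ordered by refinement. $\Pi_n(T)$ is the induced subposet of $\Pi_n$ consisting of all partitions $\pi$ such that the block of $\pi$ containing $n$ is either a singleton or meets $T$ (it is the intersection lattice of the arrangement $\{x_i=x_j:1\le i<j\le n-1\}\cup\{x_n=x_i:i\in T\}$ in $\mathbb{R}^n$). $\overline{\Pi_n(T)}$ denotes $\Pi_n(T)$ with its minimum and maximum removed; homology is that of the order complex. To split $\omega\in S_n$ at positions $i_1<\dots<i_k$ in $[n-1]$ is to form the partition with blocks $\{\omega(1),\dots,\omega(i_1)\},\{\omega(i_1+1),\dots,\omega(i_2)\},\dots,\{\omega(i_k+1),\dots,\omega(n)\}$ (no positions gives the one-block partition). $\Pi_\omega$ is the induced subposet of $\Pi_n$ of all partitions obtained by splitting $\omega$; it is a Boolean lattice, so the order complex of its proper part $\overline\Pi_\omega$ is an $(n-3)$-sphere, whose fundamental cycle (up to sign) is $\rho_\omega$. *)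

(* Defs.v *)
From HB Require Import structures.
From mathcomp Require Import all_boot all_order all_fingroup all_algebra.
From mathcomp Require Import boolp.

Set Implicit Arguments.
Unset Strict Implicit.
Unset Printing Implicit Defensive.

Import Order.TTheory GRing.Theory.
Local Open Scope ring_scope.

Definition is_Zbasis (M : zmodType) (I : finType) (b : I -> M) : Prop :=
  forall x : M, exists! c : {ffun I -> int}, x = \sum_i b i *~ c i.

Section ReducedHomology.
Context {disp : Order.disp_t} {V : finPOrderType disp}.
Implicit Types (P s t : {set V}) (d : int).

Definition proper_part P : {set V} :=
  [set x in P | ~~ [forall y in P, (x <= y)%O] & ~~ [forall y in P, (y <= x)%O]].

Definition order_complex P : {set {set V}} :=
  [set s : {set V} | (s \subset P) && [forall x in s, forall y in s, (x >=< y)%O]].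

(* All chain groups live in this one group; the degree and the subposet are
   imposed as conditions on the support, so that the map on chains induced by
   an inclusion of subposets is the identity. *)
Definition schain : zmodType := {ffun {set V} -> int}.

(* A simplex of dimension d has d + 1 vertices; the empty simplex, of dimension
   -1, is included, so the homology below is reduced. *)
Definition is_schain d P (c : schain) : bool :=
  [forall s, (c s != 0) ==> (s \in order_complex P) && (#|s|%:Z == d + 1)].

(* The linear extension of
   [x_0 < ... < x_k] |-> \sum_i (-1)^i [x_0 < ... omit x_i ... < x_k]. *)
Definition sboundary (c : schain) : schain :=
  [ffun t => \sum_(s : {set V}) \sum_(x in s | s :\ x == t)
               (-1) ^+ #|[set y in s | (y < x)%O]| * c s].

Lemma sboundaryB : {morph sboundary : a b / a - b}.
Proof.
move=> a b; apply/ffunP=> t; rewrite !ffunE -sumrB; apply: eq_bigr => s _.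
by rewrite -sumrB; apply: eq_bigr => x _; rewrite !ffunE mulrBr.
Qed.

Lemma sboundary0 : sboundary 0 = 0.
Proof. by rewrite -[X in sboundary X](subrr 0) sboundaryB subrr. Qed.

Lemma is_schain0 d P : is_schain d P 0.
Proof. by apply/forallP=> s; rewrite ffunE eqxx. Qed.

Lemma is_schainB d P a b :
  is_schain d P a -> is_schain d P b -> is_schain d P (a - b).
Proof.
move=> /forallP ha /forallP hb; apply/forallP=> s; apply/implyP.
rewrite !ffunE; have [a0|a0 _] := eqVneq (a s) 0; last exact: (implyP (ha s)).
have [b0|b0 _] := eqVneq (b s) 0; last exact: (implyP (hb s)).
by rewrite a0 b0 subrr eqxx.
Qed.

Definition is_cycle d P : {pred schain} :=
  [pred c | is_schain d P c && (sboundary c == 0)].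

Lemma is_cycle_zmod_closed d P : zmod_closed (is_cycle d P).
Proof.
split=> [|a b]; rewrite !inE ?is_schain0 ?sboundary0 ?eqxx //.
move=> /andP[ha /eqP a0] /andP[hb /eqP b0].
by rewrite is_schainB //= sboundaryB a0 b0 subrr.
Qed.

HB.instance Definition _ d P :=
  GRing.isZmodClosed.Build schain (is_cycle d P) (is_cycle_zmod_closed d P).

Record cycles d P := Cycle { cycle_val :> schain; _ : cycle_val \in is_cycle d P }.

HB.instance Definition _ d P := [isSub for @cycle_val d P].
HB.instance Definition _ d P := [Choice of cycles d P by <:].
HB.instance Definition _ d P := [SubChoice_isSubZmodule of cycles d P by <:].

Definition is_boundary d P : {pred cycles d P} :=
  [pred z : cycles d P |
    `[< exists2 c : schain, is_schain (d + 1) P c & sboundary c = val z >]].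

Lemma is_boundary_zmod_closed d P : zmod_closed (@is_boundary d P).
Proof.
split=> [|a b]; rewrite !inE.
  by apply/asboolP; exists 0; [exact: is_schain0 | rewrite sboundary0 raddf0].
move=> /asboolP[x hx ex] /asboolP[y hy ey]; apply/asboolP.
by exists (x - y); [exact: is_schainB | rewrite sboundaryB ex ey raddfB].
Qed.

HB.instance Definition _ d P :=
  GRing.isZmodClosed.Build (cycles d P) (@is_boundary d P)
    (is_boundary_zmod_closed d P).

Definition homology d P : zmodType := Quotient.quot (@is_boundary d P).

Definition homology_class d P (c : schain) (hc : c \in is_cycle d P) :
  homology d P := \pi_(Quotient.quot (@is_boundary d P))%qT (Cycle hc).

Definition homology_basis d P (I : finType) (z : I -> schain) : Prop :=
  exists hz : forall i, z i \in is_cycle d P,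
    is_Zbasis (fun i => homology_class (hz i)).

(* A generator of the infinite cyclic group homology d P, for P whose order
   complex is a d-sphere. It is determined up to sign. *)
Definition fundamental_cycle d P (z : schain) : Prop :=
  homology_basis d P (fun _ : unit => z).

End ReducedHomology.

Arguments schain {disp} V.

Definition setpart (n : nat) := {B : {set {set 'I_n}} | partition B [set: 'I_n]}.
HB.instance Definition _ n := SubFinite.on (setpart n).

Section Refinement.
Variable n : nat.
Implicit Types p q r : setpart n.

Definition refines p q : bool :=
  [forall A in val p, exists B in val q, A \subset B].

Lemma refines_refl : reflexive refines.
Proof. by move=> p; apply/forall_inP=> A hA; apply/exists_inP; exists A. Qed.

Lemma refines_trans : transitive refines.
Proof.
move=> q p r /forall_inP pq /forall_inP qr; apply/forall_inP=> A /pq.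
move=> /exists_inP[B /qr/exists_inP[C hC BC] AB]; apply/exists_inP.
by exists C => //; apply: subset_trans BC.
Qed.

Lemma refines_sub p q : refines p q -> refines q p -> val p \subset val q.
Proof.
move=> /forall_inP pq /forall_inP qp; apply/subsetP=> A hA.
have /exists_inP[B hB AB] := pq A hA; have /exists_inP[C hC BC] := qp B hB.
have /and3P[_ /trivIsetP triv /negP p0] := valP p.
have [AC|neq] := eqVneq A C.
  by suff -> : A = B by []; apply/eqP; rewrite eqEsubset AB AC BC.
have := triv A C hA hC neq.
rewrite disjoints_subset => AC; case: p0.
suff /eqP <- : A == set0 by [].
have AsubC := subset_trans AB BC.
by rewrite -subset0 -(setICr C) subsetI AsubC AC.
Qed.

Lemma refines_anti : antisymmetric refines.
Proof.
move=> p q /andP[pq qp]; apply/val_inj/eqP.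
by rewrite eqEsubset !refines_sub.
Qed.

End Refinement.

Fact refinement_display : Order.disp_t. Proof. exact: (Order.Disp tt tt). Qed.

HB.instance Definition _ n := Order.Le_isPOrder.Build refinement_display
  (setpart n) (@refines_refl n) (@refines_anti n) (@refines_trans n).

(* The set [n+1] is 'I_n.+1, with k represented by the ordinal k - 1; in
   particular its largest element is ord_max. *)
Definition PiT n (T : {set 'I_n.+1}) : {set setpart n.+1} :=
  [set p : setpart n.+1 |
    (pblock (val p) ord_max == [set ord_max])
    || ~~ [disjoint pblock (val p) ord_max & T]].

(* s is the increasing sequence i_1 < ... < i_k of splitting positions. With
   0-based ordinals the positions i_a + 1, ..., i_(a+1) of w are the j such that
   i_a <= j < i_(a+1), where i_0 = 0 and i_(k+1) = n. *)
Definition split_blocks n (w : 'S_n) (s : seq nat) : {set {set 'I_n}} :=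
  [set B in [seq [set w j | j : 'I_n & (p.1 <= j < p.2)%N]
            | p <- zip (0 :: s)%N (rcons s n)]].

(* The sets of splitting positions in {1, ..., n-1} are the images of the
   I : {set 'I_n.-1} under i |-> i + 1; enum I is increasing. *)
Definition Pi_perm n (w : 'S_n) : {set setpart n} :=
  [set p : setpart n | [exists I : {set 'I_n.-1},
    val p == split_blocks w [seq (i : 'I_n.-1).+1 | i <- enum I]]].

(* Main.v *)
Require Import Defs.
From HB Require Import structures.
From mathcomp Require Import all_boot all_order all_fingroup all_algebra.
From mathcomp Require Import boolp zify.

(* Since n - 3 is the top dimension, the homology group is the group of cycles.
   Call a maximal chain of partitions a hook chain if in all its members the
   block of n is the only nontrivial one. A top cycle is determined by its values
   on hook chains: any other maximal chain has a member x such that passing to x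
   merges two blocks without n and leaving x enlarges the block of n; exchanging
   x for any other partition makes the block of n larger there, so the cycle
   condition expresses the coefficient of the chain through those of chains with
   a larger total size of the blocks of n. The same induction shows that a common
   divisor of the coefficients on hook chains divides all coefficients.
   The hook chains of Pi_n(T) correspond to the w with w(n) = n and w(n-1) in T
   (the block of n grows by w(n-1), w(n-2), ...), and the one given by w is the
   only hook chain of Pi_w. Its coefficient in rho_w thus divides rho_w and is
   1 or -1 because rho_w is a generator. So the matrix of coefficients of the
   rho_w on the hook chains is diagonal with entries 1 and -1. *)

Set Implicit Arguments.
Unset Strict Implicit.
Unset Printing Implicit Defensive.

Import Order.TTheory GRing.Theory.
Local Open Scope ring_scope.

(** Pigeonhole; it is applied to [nblocks], which is injective on chains of partitions. *)
Lemma inj_nat_range_card (X : finType) (f : X -> nat) (s : {set X}) (a m : nat) :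
    {in s &, injective f} -> {in s, forall x, (a <= f x < a + m)%N} ->
  (#|s| <= m)%N /\
  (#|s| = m -> forall k, (a <= k < a + m)%N -> exists2 x, x \in s & f x = k).
Proof.
move=> fI fR.
have U : uniq [seq f x | x <- enum s].
  by rewrite map_inj_in_uniq ?enum_uniq // => x y; rewrite !mem_enum; apply: fI.
have sub : {subset [seq f x | x <- enum s] <= iota a m}.
  by move=> k /mapP[x]; rewrite mem_enum => /fR xs ->; rewrite mem_iota.
have sz : size [seq f x | x <- enum s] = #|s| by rewrite size_map -cardE.
split; first by have := uniq_leq_size U sub; rewrite sz size_iota.
move=> sm k kR; have [|_ eqi] := uniq_min_size U sub.
  by rewrite sz size_iota sm.
have : k \in [seq f x | x <- enum s] by rewrite eqi mem_iota.
by case/mapP=> x; rewrite mem_enum => xs ->; exists x.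
Qed.

(** * Refinement of set partitions through blocks and their number *)

Section SetPartitions.
Variable n : nat.
Implicit Types p q : setpart n.

Lemma cover_setpart p : cover (val p) = [set: 'I_n].
Proof. by apply/eqP; case/and3P: (valP p). Qed.

Lemma trivIset_setpart p : trivIset (val p).
Proof. by case/and3P: (valP p). Qed.

Lemma mem_pblock_setpart p i : i \in pblock (val p) i.
Proof. by rewrite mem_pblock cover_setpart inE. Qed.

Lemma pblock_in_setpart p i : pblock (val p) i \in val p.
Proof. by rewrite pblock_mem // cover_setpart inE. Qed.

Lemma pblock_setpartP p A : A \in val p -> exists i, A = pblock (val p) i.
Proof.
move=> pA; have /set0Pn[i iA] : A != set0.
  by apply: contraTneq pA => ->; case/and3P: (valP p).
by exists i; rewrite (def_pblock (trivIset_setpart p) pA iA).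
Qed.

Lemma le_setpartP p q :
  reflect (forall i, pblock (val p) i \subset pblock (val q) i) (p <= q)%O.
Proof.
apply: (iffP forall_inP) => [h i | h A /pblock_setpartP[i ->]].
  have /exists_inP[B qB AB] := h _ (pblock_in_setpart p i).
  by rewrite (def_pblock (trivIset_setpart q) qB) // (subsetP AB) ?mem_pblock_setpart.
by apply/exists_inP; exists (pblock (val q) i); rewrite ?pblock_in_setpart.
Qed.

Lemma same_pblock_setpart p i j :
  j \in pblock (val p) i -> pblock (val p) j = pblock (val p) i.
Proof. exact/same_pblock/trivIset_setpart. Qed.

Lemma setpart_imset p : val p = [set pblock (val p) i | i : 'I_n].
Proof.
apply/setP=> A; apply/idP/imsetP => [/pblock_setpartP[i ->]|[i _ ->]].
  by exists i.
exact: pblock_in_setpart.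
Qed.

(** Each block [A] of [p] lies in one block of [q], and the union recovers that block without
    choosing an element of [A]. *)
Lemma le_setpart_imset p q : (p <= q)%O ->
  val q = [set (\bigcup_(i in A) pblock (val q) i) | A : {set 'I_n} in val p].
Proof.
move=> /le_setpartP pq; rewrite {1}setpart_imset (setpart_imset p) -imset_comp.
apply: eq_imset => i /=; apply/setP=> j; apply/idP/bigcupP => [ij|[k ki kj]].
  by exists i; rewrite ?mem_pblock_setpart.
by rewrite -(same_pblock_setpart (subsetP (pq i) _ ki)).
Qed.

Definition nblocks p : nat := #|val p|.

Lemma le_setpart_card p q : (p <= q)%O -> (nblocks q <= nblocks p)%N.
Proof. by move=> pq; rewrite /nblocks (le_setpart_imset pq) leq_imset_card. Qed.

(** The map from blocks of [p] to the blocks of [q] containing them is onto; equal counts make it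
    injective, so elements sharing a block of [q] already share one of [p]. *)
Lemma le_card_setpart_eq p q : (p <= q)%O -> (nblocks p <= nblocks q)%N -> p = q.
Proof.
move=> pq cpq; apply/le_anti; rewrite pq /=; have /le_setpartP pqP := pq.
have /imset_injP fI : #|[set (\bigcup_(i in A) pblock (val q) i)
     | A : {set 'I_n} in val p]| == #|val p|.
  rewrite -(le_setpart_imset pq) -/(nblocks q) -/(nblocks p) eqn_leq cpq.
  by rewrite le_setpart_card.
have fE i : \bigcup_(k in pblock (val p) i) pblock (val q) k = pblock (val q) i.
  apply/setP=> j; apply/bigcupP/idP => [[k ki kj]|ij]; last first.
    by exists i; rewrite ?mem_pblock_setpart.
  by rewrite -(same_pblock_setpart (subsetP (pqP i) _ ki)).
apply/le_setpartP=> i; apply/subsetP=> j ij.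
rewrite (fI _ (pblock (val p) j) (pblock_in_setpart _ _)) ?pblock_in_setpart //.
  exact: mem_pblock_setpart.
by rewrite !fE (same_pblock_setpart ij).
Qed.

Lemma comparable_card_setpart p q :
  (p >=< q)%O -> (nblocks q <= nblocks p)%N -> (p <= q)%O.
Proof. by case/orP=> // qp cqp; rewrite (le_card_setpart_eq qp cqp). Qed.

Lemma comparable_card_setpart_inj p q :
  (p >=< q)%O -> nblocks q = nblocks p -> p = q.
Proof.
move=> pq cpq; apply: le_card_setpart_eq; last by rewrite cpq.
by apply: comparable_card_setpart => //; rewrite cpq.
Qed.

Definition fiber_setpart (rT : eqType) (f : 'I_n -> rT) : setpart n :=
  exist _ (preim_partition f [set: 'I_n]) (preim_partitionP f _).

Lemma mem_pblock_fiber (rT : eqType) (f : 'I_n -> rT) i j :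
  (j \in pblock (val (fiber_setpart f)) i) = (f i == f j).
Proof.
rewrite /= /preim_partition pblock_equivalence_partition ?inE //.
by split=> // /eqP->.
Qed.

Definition part_bot : setpart n := fiber_setpart id.
Definition part_top : setpart n := fiber_setpart (fun=> tt).

Lemma pblock_bot i : pblock (val part_bot) i = [set i].
Proof. by apply/setP=> j; rewrite mem_pblock_fiber inE eq_sym. Qed.

Lemma pblock_top i : pblock (val part_top) i = setT.
Proof. by apply/setP=> j; rewrite mem_pblock_fiber inE. Qed.

Lemma part_bot_le p : (part_bot <= p)%O.
Proof.
by apply/le_setpartP=> i; rewrite pblock_bot sub1set mem_pblock_setpart.
Qed.

Lemma le_part_top p : (p <= part_top)%O.
Proof. by apply/le_setpartP=> i; rewrite pblock_top subsetT. Qed.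

Lemma card_part_bot : nblocks part_bot = n.
Proof.
rewrite /nblocks setpart_imset (eq_imset _ pblock_bot) card_imset ?card_ord //.
exact: set1_inj.
Qed.
End SetPartitions.

(** * The block of the largest element, and hooks *)

Section LastBlock.
Variable n : nat.
Implicit Types p q x y : setpart n.+1.

Definition last_block p : {set 'I_n.+1} := pblock (val p) ord_max.

Lemma card_part_top : nblocks (part_top n.+1) = 1%N.
Proof.
apply/eqP/cards1P; exists setT; apply/setP=> A; rewrite inE; apply/idP/eqP.
  by case/pblock_setpartP=> i ->; rewrite pblock_top.
by move=> ->; have := pblock_in_setpart (part_top n.+1) ord0; rewrite pblock_top.
Qed.

Lemma le_last_block p q : (p <= q)%O -> last_block p \subset last_block q.
Proof. by move/le_setpartP; apply. Qed.

(* Both x and y are the partition obtained from c by splitting its last block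
   into last_block x and the rest. *)
Lemma last_block_cover_inj x y c :
    (x <= c)%O -> (y <= c)%O -> nblocks x = (nblocks c).+1 ->
    nblocks y = nblocks x -> last_block x = last_block y ->
    last_block x != last_block c ->
  x = y.
Proof.
move=> xc yc cx cy eB neB.
pose q := fiber_setpart (fun i => (pblock (val c) i, i \in last_block x)).
have qc : (q <= c)%O.
  apply/le_setpartP=> i; apply/subsetP=> j; rewrite mem_pblock_fiber.
  by case/eqP=> -> _; rewrite mem_pblock_setpart.
have ltqc : (nblocks c < nblocks q)%N.
  rewrite ltnNge; apply: contra neB => /(le_card_setpart_eq qc) eqc.
  rewrite eqEsubset le_last_block //; apply/subsetP=> j; rewrite -eqc.
  rewrite mem_pblock_fiber => /eqP[_ <-].
  exact: mem_pblock_setpart.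
suff qE z : (z <= c)%O -> nblocks z = nblocks x -> last_block z = last_block x ->
    z = q by rewrite (qE x) // (qE y).
move=> zc cz eBz; apply: le_card_setpart_eq; last by rewrite cz cx.
apply/le_setpartP=> i; apply/subsetP=> j ij.
rewrite mem_pblock_fiber; apply/eqP; congr (_, _).
  by apply/esym/same_pblock_setpart; apply: (subsetP (le_setpartP _ _ zc i)).
rewrite -eBz /last_block.
rewrite -!(eq_pblock _ (trivIset_setpart z)) ?cover_setpart ?inE //.
by rewrite (same_pblock_setpart ij).
Qed.

(** This is the equality case of [card_hook_leqif]: every block other than the last one is a
    singleton. *)
Definition hook p : bool := (nblocks p + #|last_block p| == n.+2)%N.

Lemma card_setpart_sum p :
  n.+1 = (#|last_block p| +
          \sum_(A in val p | A != last_block p) #|A|)%N.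
Proof.
have := card_partition (valP p); rewrite cardsT card_ord {1}(bigD1 (last_block p)) //.
exact: pblock_in_setpart.
Qed.

Lemma card_setpart_other p :
  nblocks p = (\sum_(A in val p | A != last_block p) 1).+1.
Proof.
by rewrite /nblocks -sum1_card (bigD1 (last_block p)) // pblock_in_setpart.
Qed.

(** The block sizes sum to [n.+1], and each block other than the last has size at least 1, with
    equality exactly for singletons. *)
Lemma card_hook_leqif p :
  (nblocks p + #|last_block p| <= n.+2 ?=
   iff [forall A : {set 'I_n.+1},
          (A \in val p) && (A != last_block p) ==> (#|A| == 1)])%N.
Proof.
have h (A : {set 'I_n.+1}) : (A \in val p) && (A != last_block p) ->
  (1 <= #|A| ?= iff (#|A| == 1))%N.
  case/andP=> /pblock_setpartP[i ->] _; split; last by rewrite eq_sym.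
  by apply/card_gt0P; exists i; rewrite mem_pblock_setpart.
have {h} := leqif_sum h; rewrite card_setpart_other.
have := card_setpart_sum p; set S := (\sum_(A in _ | _) #|_|)%N => eS.
set S1 := (\sum_(A in _ | _) 1)%N => -[le <-]; split; first by lia.
by apply/eqP/eqP; lia.
Qed.

Lemma hookP p :
  reflect (forall i, i \notin last_block p -> pblock (val p) i = [set i]) (hook p).
Proof.
rewrite /hook card_hook_leqif; apply: (iffP forall_inP) => [h i iB|h A].
  have /cards1P[j eB] : #|pblock (val p) i| == 1%N.
    apply: h; rewrite pblock_in_setpart; apply: contraNneq iB => <-.
    exact: mem_pblock_setpart.
  by have := mem_pblock_setpart p i; rewrite eB inE => /eqP <-.
case/andP=> /pblock_setpartP[i ->] neB; rewrite h ?cards1 //.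
by apply: contraNN neB => /same_pblock_setpart->.
Qed.

Lemma hook_le p q : hook p -> last_block p \subset last_block q -> (p <= q)%O.
Proof.
move/hookP=> hp pq; apply/le_setpartP=> i.
have [iB|iB] := boolP (i \in last_block p); last first.
  by rewrite hp // sub1set mem_pblock_setpart.
by rewrite (same_pblock_setpart iB) (same_pblock_setpart (subsetP pq i iB)).
Qed.

Lemma hook_inj p q : hook p -> hook q -> last_block p = last_block q -> p = q.
Proof. by move=> hp hq e; apply/le_anti; rewrite !hook_le // e. Qed.

Lemma hook_bot : hook (part_bot n.+1).
Proof. by rewrite /hook card_part_bot /last_block pblock_bot cards1 addn1. Qed.

Lemma hook_top : hook (part_top n.+1).
Proof. by rewrite /hook card_part_top /last_block pblock_top cardsT card_ord. Qed.

End LastBlock.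

(** * Homology in the top degree *)

Section TopHomology.
Context {disp : Order.disp_t} {V : finPOrderType disp}.
Implicit Types (P Q s t : {set V}) (d : int) (c : schain V).

Lemma order_complexP P s :
  reflect (s \subset P /\ {in s &, forall x y, (x >=< y)%O})
          (s \in order_complex P).
Proof.
rewrite inE; apply: (iffP andP) => -[sP h]; split=> //.
  by move=> x y xs ys; exact: (forall_inP (forall_inP h x xs) y ys).
by apply/forall_inP=> x xs; apply/forall_inP=> y ys; apply: h.
Qed.

Lemma is_schain_supp d P c s : is_schain d P c -> c s != 0 ->
  s \in order_complex P /\ #|s|%:Z = d + 1.
Proof. by move=> /forallP/(_ s)/implyP h /h/andP[-> /eqP->]. Qed.

Lemma is_cycle_sub d P Q c :
  P \subset Q -> c \in is_cycle d P -> c \in is_cycle d Q.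
Proof.
move=> PQ; rewrite !inE => /andP[hc ->]; rewrite andbT.
apply/forallP=> s; apply/implyP=> cs0.
have [/order_complexP[sP h] ->] := is_schain_supp hc cs0.
by rewrite eqxx andbT; apply/order_complexP; split=> //; apply: subset_trans PQ.
Qed.

(** Without nonzero chains in degree [d + 1] there are no nonzero boundaries, so classes can be
    replaced by the cycles themselves. *)
Lemma top_homology_basis d P (I : finType) (z : I -> schain V) :
    (forall c, is_schain (d + 1) P c -> c = 0) ->
  homology_basis d P z <->
  (forall i, z i \in is_cycle d P) /\
  (forall x, x \in is_cycle d P ->
     exists! c : {ffun I -> int}, x = \sum_i z i *~ c i).
Proof.
move=> top0.
have key (hz : forall i, z i \in is_cycle d P) (x : cycles d P)
    (c : {ffun I -> int}) :
    \pi_(homology d P)%qT x = \sum_i homology_class (hz i) *~ c i <->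
    val x = \sum_i z i *~ c i.
  have -> : \sum_i homology_class (hz i) *~ c i =
      \pi_(homology d P)%qT (\sum_i Cycle (hz i) *~ c i).
    by rewrite raddf_sum; apply: eq_bigr => i _; rewrite raddfMz.
  have -> : \sum_i z i *~ c i = val (\sum_i Cycle (hz i) *~ c i).
    by rewrite raddf_sum; apply: eq_bigr => i _; rewrite raddfMz.
  split=> [/eqP|/val_inj->//].
  rewrite -Quotient.idealrBE inE => /asboolP[b /top0->].
  by rewrite sboundary0 raddfB => /esym/eqP; rewrite subr_eq0 => /eqP.
split=> [[hz B]|[hz B]].
  split=> // x hx; have [c [xc uc]] := B (\pi_(homology d P)%qT (Cycle hx)).
  exists c; split; first exact/(key hz (Cycle hx)).
  by move=> c' /(key hz (Cycle hx)); apply: uc.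
exists hz; elim/quotW=> -[x hx].
have [c [xc uc]] := B x hx; exists c; split; first exact/key.
by move=> c' /key; apply: uc.
Qed.

End TopHomology.

(** * Maximal chains and the exchange argument *)

Section Facets.
Variable n : nat.
Implicit Types (P s : {set setpart n.+2}) (x y : setpart n.+2).

Definition inner P : Prop := {in P, forall x, (1 < nblocks x < n.+2)%N}.

Definition facet P s : bool := (s \in order_complex P) && (#|s| == n).

(** On a chain [nblocks] is injective, with values among the [n] numbers from 2 to [n.+1]. *)
Lemma card_order_complex_inner P s : inner P -> s \in order_complex P ->
  (#|s| <= n)%N /\
  (#|s| = n -> forall k, (1 < k < n.+2)%N -> exists2 x, x \in s & nblocks x = k).
Proof.
move=> hP /order_complexP[/subsetP sP cs].
apply: (@inj_nat_range_card _ (fun x : setpart n.+2 => nblocks x)).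
  move=> x y xs ys /= e; apply: comparable_card_setpart_inj => //.
  exact: cs.
by move=> x /sP/hP; rewrite add2n.
Qed.

Lemma inner_schain0 P c : inner P -> is_schain (n.+2%:Z - 3 + 1) P c -> c = 0.
Proof.
move=> hP hc; apply/ffunP=> s; rewrite ffunE; apply/eqP.
have [//|/(is_schain_supp hc)[so e]] := eqVneq (c s) 0.
have [cs _] := card_order_complex_inner hP so.
by exfalso; move: #|s| cs e => k; lia.
Qed.

(** Adding both extremes gives every member of a facet a neighbour on each side. *)
Definition bounded s : {set setpart n.+2} :=
  part_bot n.+2 |: (part_top n.+2 |: s).

Lemma bounded_comparable P s : s \in order_complex P ->
  {in bounded s &, forall x y, (x >=< y)%O}.
Proof.
move=> /order_complexP[_ cs] x y; rewrite !inE /Order.comparable.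
case/or3P=> [/eqP->|/eqP->|xs]; rewrite ?part_bot_le ?le_part_top ?orbT //.
case/or3P=> [/eqP->|/eqP->|ys]; rewrite ?part_bot_le ?le_part_top ?orbT //.
exact: cs.
Qed.

Lemma facet_rank P s k : inner P -> facet P s -> (0 < k <= n.+2)%N ->
  exists2 x, x \in bounded s & nblocks x = k.
Proof.
move=> hP /andP[so /eqP cs] /andP[k0 kn].
have [k1|k1] := eqVneq k 1%N.
  by exists (part_top n.+2); rewrite ?card_part_top // !inE eqxx orbT.
have [k2|k2] := eqVneq k n.+2.
  by exists (part_bot n.+2); rewrite ?card_part_bot // !inE eqxx.
have [|x xs xk] := (card_order_complex_inner hP so).2 cs k; first by lia.
by exists x; rewrite // !inE xs !orbT.
Qed.

Lemma bounded_rank_inj P s : s \in order_complex P ->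
  {in bounded s &, injective (fun x => nblocks x)}.
Proof.
move=> so x y xs ys e; apply: comparable_card_setpart_inj => //.
exact: (bounded_comparable so).
Qed.

Lemma bounded_rank_le P s x y : s \in order_complex P ->
  x \in bounded s -> y \in bounded s -> (nblocks y <= nblocks x)%N -> (x <= y)%O.
Proof.
move=> so xs ys; apply: comparable_card_setpart; exact: (bounded_comparable so).
Qed.

(* Along a maximal chain nblocks x + #|last_block x| starts and ends at its
   maximum n.+3, drops by one when two blocks other than the last one are merged
   and does not drop otherwise. At the first minimum x, the last block thus stays
   the same on the way to x and grows right after it. *)
Lemma facet_exchange P s : inner P -> facet P s -> ~~ [forall x in s, hook x] ->
  exists2 x, x \in s & forall y, y != x -> y \notin s :\ x ->
    facet P (y |: s :\ x) -> (#|last_block x| < #|last_block y|)%N.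
Proof.
move=> hP fs; rewrite negb_forall_in => /exists_inP[x0 x0s hx0].
pose m x := (nblocks x + #|last_block x|)%N.
case: (@arg_minnP _ x0 (mem s) m x0s) => x1 x1s min1.
(* Among the minimizers of [m], the one with the most blocks is the lowest in the chain. *)
pose S := [pred x | (x \in s) && (m x == m x1)].
have Sx1 : S x1 by rewrite /= eqxx andbT.
case: (@arg_maxnP _ x1 S (fun x => nblocks x) Sx1) => x /andP[xs /eqP mx] maxx.
have {maxx} maxx z : z \in s -> m z = m x -> (nblocks z <= nblocks x)%N.
  by move=> zs mz; apply: maxx; rewrite /= zs mz mx eqxx.
rewrite -mx in min1.
have hS z : z \in bounded s -> (m z < n.+3)%N -> z \in s.
  rewrite !inE => /or3P[/eqP->|/eqP->|//].
    by have /eqP := hook_bot n.+1; rewrite -/(m _) => ->; rewrite ltnn.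
  by have /eqP := hook_top n.+1; rewrite -/(m _) => ->; rewrite ltnn.
have mle z : (m z <= n.+3)%N by rewrite /m card_hook_leqif.
have mltx : (m x < n.+3)%N.
  by apply: leq_ltn_trans (min1 _ x0s) _; rewrite ltn_neqAle mle andbT.
have /andP[so /eqP cs] := fs; have /order_complexP[/subsetP sP _] := so.
have /andP[x_gt1 x_ltn] := hP x (sP x xs).
have xb : x \in bounded s by rewrite !inE xs !orbT.
(* [a] and [c] are the neighbours of [x] just below and just above it; either may be an extreme
   partition. *)
have [|a ab ca] := @facet_rank P s (nblocks x).+1 hP fs; first by lia.
have [|c cb cc] := @facet_rank P s (nblocks x).-1 hP fs; first by lia.
have ax : (a <= x)%O by apply: (bounded_rank_le so); rewrite ?ca.
have xc : (x <= c)%O by apply: (bounded_rank_le so); rewrite ?cc ?leq_pred.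
have ma : (m x < m a)%N.
  have [ma|] := ltnP (m a) n.+3; last exact: leq_trans mltx.
  have as_ := hS a ab ma; have := min1 a as_; rewrite leq_eqVlt.
  case/orP=> // /eqP e; by have := maxx a as_ (esym e); rewrite ca ltnn.
have mc : (m x <= m c)%N.
  have [mc|] := ltnP (m c) n.+3; first exact: min1 (hS c cb mc).
  exact: leq_trans (mle x).
have eBa : last_block a = last_block x.
  apply/eqP; rewrite eqEcard le_last_block //=.
  by move: ma; rewrite /m ca addSn ltnS leq_add2l.
have neBc : last_block x != last_block c.
  apply: contraTneq mc => e.
  by rewrite /m cc e -ltnNge ltn_add2r ltn_predL (ltnW x_gt1).
exists x => // y yx ys fy; have /andP[yo /eqP cy] := fy.
have sub z : z \in bounded s -> z != x -> z \in bounded (y |: s :\ x).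
  by rewrite !inE => /or3P[->|->|->] // ->; rewrite ?orbT.
have yb : y \in bounded (y |: s :\ x) by rewrite !inE eqxx !orbT.
(* The rank of [x] must occur in the new chain too. A member of that rank other than [y] would come
   from the old chain, hence would be [x], which was removed. *)
have cyx : nblocks y = nblocks x.
  have [|w wb cw] := @facet_rank P (y |: s :\ x) (nblocks x) hP fy.
    by rewrite (ltnW x_gt1) (ltnW x_ltn).
  have [<- //|wy] := eqVneq w y.
  have wx : w = x; last first.
    move: wb; rewrite wx !inE eqxx [x == y]eq_sym (negPf yx) /= orbF.
    case/orP=> /eqP e; move: x_gt1 x_ltn; rewrite e ?card_part_bot ?card_part_top //.
    by rewrite ltnn.
  apply: (bounded_rank_inj so) => //; move: wb; rewrite !inE (negPf wy) /=.
  by case/or3P=> [->|->|/andP[_ ->]]; rewrite ?orbT.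
have ay : (a <= y)%O.
  apply: (bounded_rank_le yo) => //; last by rewrite cyx ca.
  by apply: sub => //; apply: contra_eq_neq ca => ->; rewrite neq_ltn ltnSn.
have yc : (y <= c)%O.
  apply: (bounded_rank_le yo) => //; last by rewrite cyx cc leq_pred.
  apply: sub => //; apply: contra_eq_neq cc => ->.
  by rewrite neq_ltn ltn_predL (ltnW x_gt1) orbT.
(* Since [a <= y], the last block of [y] contains that of [x]; equality would force [y = x], both
   lying just below [c]. *)
rewrite -eBa; apply: proper_card; rewrite properEneq le_last_block // andbT eBa.
apply: contra yx => /eqP e; rewrite eq_sym; apply/eqP.
by apply: (last_block_cover_inj xc yc) => //; rewrite cc prednK // ltnW.
Qed.

Lemma sum_last_block_le s : (\sum_(x in s) #|last_block x| <= #|s| * n.+2)%N.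
Proof.
rewrite -sum_nat_const; apply: leq_sum => x _.
by rewrite -[leqRHS]card_ord max_card.
Qed.

Lemma cycle_supp P z s : z \in is_cycle (n.+2%:Z - 3) P -> z s != 0 -> facet P s.
Proof.
rewrite inE => /andP[hz _] /(is_schain_supp hz)[so cs].
by rewrite /facet so; apply/eqP; move: #|s| cs => k; lia.
Qed.

(** Divisibility serves two purposes: [k = 0] says that a cycle vanishing on hook facets is zero,
    and a nonzero [k] allows a cycle to be divided by [k]. *)
Lemma dvdz_cycle P z (k : int) : inner P -> z \in is_cycle (n.+2%:Z - 3) P ->
    (forall s, facet P s -> [forall x in s, hook x] -> (k %| z s)%Z) ->
  forall s, (k %| z s)%Z.
Proof.
move=> hP zP hk s; have [->|] := eqVneq (z s) 0; first exact: dvdz0.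
move=> /(cycle_supp zP).
(* Induction on how far the total size of the last blocks falls short of [n * n.+2], an upper bound
   by [sum_last_block_le]. *)
move: {2}(n * n.+2 - \sum_(x in s) #|last_block x|)%N (leqnn
  (n * n.+2 - \sum_(x in s) #|last_block x|)%N) => m.
elim/ltn_ind: m s => m IH s sm fs.
have [/hk|nh] := boolP [forall x in s, hook x]; first exact.
have [x xs hx] := facet_exchange hP fs nh.
(* The boundary coefficient at [s :\ x] isolates [z s] up to sign; the other terms come from the
   facets [y |: s :\ x], whose total is larger. *)
move: (zP); rewrite inE => /andP[_ /eqP/ffunP/(_ (s :\ x))].
rewrite !ffunE (bigD1 s) //= (bigD1 x) ?xs ?eqxx //= big1 ?addr0; last first.
  move=> y /andP[/andP[ys /eqP e] yx]; have : y \in s :\ x by rewrite !inE yx.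
  by rewrite -e !inE eqxx.
move/eqP; rewrite addr_eq0 => /eqP e.
suff : (k %| (-1) ^+ #|[set y in s | (y < x)%O]| * z s)%Z by rewrite rpredMsign.
rewrite e rpredN; apply: rpred_sum => s' ss'; apply: rpred_sum => y.
case/andP=> ys' /eqP es'; rewrite rpredMsign.
have [->|/(cycle_supp zP) fs'] := eqVneq (z s') 0; first exact: dvdz0.
have s'E : s' = y |: s :\ x by rewrite -es' setD1K.
have yx : y != x by apply: contraNneq ss' => yx; rewrite s'E yx setD1K.
have yns : y \notin s :\ x by rewrite -es' !inE eqxx.
have ltB : (#|last_block x| < #|last_block y|)%N by apply: hx; rewrite -?s'E.
apply: (IH (n * n.+2 - \sum_(x in s') #|last_block x|)%N) => //.
have /andP[_ /eqP cs'] := fs'; have := sum_last_block_le s'; rewrite cs'.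
have -> : (\sum_(i in s') #|last_block i| =
    #|last_block y| + \sum_(i in s :\ x) #|last_block i|)%N.
  by rewrite (big_setD1 y) //= es'.
move: sm ltB; rewrite (big_setD1 x xs) /=.
move: (\sum_(i in _) _)%N (n * n.+2)%N #|last_block x| #|last_block y|.
by move=> S K bx by_; clear; lia.
Qed.

End Facets.

(** * Hook chains and permutations *)

Section SplittingFacets.
Variable n : nat.
Implicit Types (P Q s : {set setpart n.+2}) (x y : setpart n.+2) (w u v : 'S_n.+2).
Implicit Type T : {set 'I_n.+2}.

(** [part_bot] and [part_top] bound all partitions, so a partition with [n.+2] blocks or a single
    block would be a minimum or maximum of [P]. *)
Lemma inner_proper_part P : inner (proper_part P).
Proof.
move=> x; rewrite inE => /and3P[_ xb xt]; apply/andP; split.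
  rewrite ltnNge; apply: contra xt => x1; apply/forall_inP=> y _.
  by rewrite (le_card_setpart_eq (le_part_top x)) ?le_part_top ?card_part_top.
rewrite ltnNge; apply: contra xb => xn; apply/forall_inP=> y _.
by rewrite -(le_card_setpart_eq (part_bot_le x)) ?part_bot_le ?card_part_bot.
Qed.

Lemma proper_part_sub P Q : part_bot n.+2 \in Q -> part_top n.+2 \in Q ->
  P \subset Q -> proper_part P \subset proper_part Q.
Proof.
move=> bQ tQ /subsetP PQ; apply/subsetP=> x xP.
have /andP[x_gt1 x_ltn] := inner_proper_part xP.
move: xP; rewrite !inE => /andP[/PQ-> _] /=; apply/andP; split.
  apply: contraTN x_ltn => /forall_inP/(_ _ bQ)/le_setpart_card.
  by rewrite card_part_bot -leqNgt.
apply: contraTN x_gt1 => /forall_inP/(_ _ tQ)/le_setpart_card.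
by rewrite card_part_top -leqNgt.
Qed.

Definition perm_tail w (i : nat) : {set 'I_n.+2} :=
  [set w j | j : 'I_n.+2 & (i <= j)%N].

Lemma mem_perm_tail w i j : (w j \in perm_tail w i) = (i <= j)%N.
Proof. by rewrite mem_imset ?inE //; apply: perm_inj. Qed.

Lemma card_perm_tail w i : #|perm_tail w i| = (n.+2 - i)%N.
Proof.
rewrite card_imset; last exact: perm_inj.
rewrite -sum1dep_card -[RHS]muln1 -sum_nat_const_nat big_geq_mkord.
by apply: eq_bigl.
Qed.

(** The last block is the image of an interval of positions containing the last position, so its
    upper end bounds all positions. *)
Lemma Pi_perm_last_block w x : w ord_max = ord_max -> x \in Pi_perm w ->
  exists2 i, (i < n.+2)%N & last_block x = perm_tail w i.
Proof.
move=> wm; rewrite inE => /existsP[I /eqP xE].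
have := pblock_in_setpart x ord_max; rewrite {2}xE inE => /mapP[[a b] _ /= eB].
have : ord_max \in last_block x by rewrite mem_pblock_setpart.
rewrite /last_block eB -{1}wm mem_imset; last exact: perm_inj.
rewrite inE /= => /andP[an nb]; exists a => //; apply/setP=> k.
rewrite -(permKV w k) mem_perm_tail mem_imset; last exact: perm_inj.
by rewrite inE (leq_trans (ltn_ord _) nb) andbT.
Qed.

(** A tail starting at the last position, [n.+1], is the singleton of [ord_max]; any longer one
    contains [w (inord n)], the value at the 0-based position [n] just before it. *)
Lemma Pi_perm_sub_PiT w T : w ord_max = ord_max -> w (inord n) \in T ->
  Pi_perm w \subset PiT T.
Proof.
move=> wm wT; apply/subsetP=> x /(Pi_perm_last_block wm)[i ltin].
rewrite inE /last_block => ->.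
move: ltin; rewrite ltnS leq_eqVlt => /orP[/eqP->|ltin].
  suff -> : perm_tail w n.+1 = [set ord_max] by rewrite eqxx.
  apply/esym/eqP; rewrite eqEcard card_perm_tail cards1 subSnn leqnn andbT.
  by rewrite sub1set -{1}wm mem_perm_tail.
apply/orP; right; apply/pred0Pn; exists (w (inord n)).
by rewrite /= wT andbT mem_perm_tail inordK.
Qed.

(* If w fixes ord_max, this is the hook chain of Pi_perm w. *)
Definition perm_facet w : {set setpart n.+2} :=
  [set x | [&& (1 < nblocks x < n.+2)%N, hook x
             & last_block x == perm_tail w (nblocks x).-1]].

Lemma perm_facet_eq w s : s \subset perm_facet w -> #|s| = n -> s = perm_facet w.
Proof.
move=> sw cs; apply/eqP; rewrite eqEcard sw cs.
apply: (@inj_nat_range_card _ (@nblocks n.+2) _ 2 n _ _).1 => x.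
  move=> y; rewrite !inE => /and3P[_ hx /eqP ex] /and3P[_ hy /eqP ey] e.
  by apply: hook_inj => //; rewrite ex ey e.
by rewrite inE => /and3P[].
Qed.

(** A hook with [k] blocks has a last block of size [n.+3 - k]; the tail of that size starts at
    position [k.-1]. *)
Lemma hook_facet_Pi_perm w P s : w ord_max = ord_max -> inner P ->
    P \subset Pi_perm w -> facet P s -> [forall x in s, hook x] ->
  s = perm_facet w.
Proof.
move=> wm hP /subsetP Pw /andP[/order_complexP[/subsetP sP _] /eqP cs].
move=> /forall_inP hs; apply: perm_facet_eq => //; apply/subsetP=> x xs.
have hx := hs x xs; have xr := hP x (sP x xs).
rewrite inE xr hx /=; have [i ltin eB] := Pi_perm_last_block wm (Pw x (sP x xs)).
move: hx; rewrite /hook eB card_perm_tail => /eqP hx; apply/eqP; congr perm_tail.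
by move: (nblocks x) hx ltin {xr} => k; lia.
Qed.

Lemma perm_facet_inj P w u : w ord_max = ord_max -> u ord_max = ord_max ->
  inner P -> facet P (perm_facet w) -> perm_facet w = perm_facet u -> w = u.
Proof.
move=> wm um hP /andP[so /eqP cs] ewu.
(* Tails starting at positions 1 to [n] are read off the facet; the full tail, the singleton tail
   and the empty ones agree for all permutations fixing [ord_max]. *)
have tailE i : perm_tail w i = perm_tail u i.
  have [->|i0] := posnP i.
    by apply/setP=> j; rewrite -{1}(permKV w j) -(permKV u j) !mem_perm_tail.
  have [lein|ltni] := leqP i n.
    have [|x xs xi] := (card_order_complex_inner hP so).2 cs i.+1; first by lia.
    have := xs; rewrite ewu inE xi => /and3P[_ _ /eqP<-].
    by move: xs; rewrite inE xi => /and3P[_ _ /eqP<-].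
  have [e|ltni1] := eqVneq i n.+1.
    have tailm v : v ord_max = ord_max -> perm_tail v i = [set ord_max].
      move=> vm; apply/esym/eqP; rewrite e eqEcard card_perm_tail cards1 subSnn.
      by rewrite sub1set -{1}vm mem_perm_tail !leqnn.
    by rewrite !tailm.
  have tail0 v : perm_tail v i = set0.
    by apply: cards0_eq; rewrite card_perm_tail; lia.
  by rewrite !tail0.
(* The value [w i] is what the tail at [i] has and the tail at [i.+1] lacks, which pins down its
   position under [u]. *)
apply/permP=> i; rewrite -{1}(permKV u (w i)); set j := (u^-1)%g (w i).
have wuj : w i = u j by rewrite permKV.
congr (u _); apply/val_inj/eqP; rewrite /= eqn_leq.
have := mem_perm_tail w i i; rewrite tailE wuj mem_perm_tail leqnn => ->.
have := mem_perm_tail w i.+1 i; rewrite tailE wuj mem_perm_tail ltnn.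
by rewrite andbT => /negbT; rewrite -leqNgt.
Qed.

Lemma part_bot_PiT T : part_bot n.+2 \in PiT T.
Proof. by rewrite inE pblock_bot eqxx. Qed.

Lemma part_top_PiT T : T != set0 -> part_top n.+2 \in PiT T.
Proof.
case/set0Pn=> i iT; rewrite inE pblock_top; apply/orP; right.
by apply/pred0Pn; exists i; rewrite /= inE.
Qed.

(** Going up the chain, the last block grows by one element at a time; listing these elements
    backwards gives [w]. *)
Lemma hook_facet_PiT T s : T != set0 -> ord_max \notin T ->
    facet (proper_part (PiT T)) s -> [forall x in s, hook x] ->
  exists w, [/\ w ord_max = ord_max, w (inord n) \in T & s = perm_facet w].
Proof.
move=> T0 mT fs /forall_inP hs; have hP := @inner_proper_part (PiT T).
have /andP[so /eqP cs] := fs; have /order_complexP[/subsetP sP _] := so.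
have hb x : x \in bounded s -> hook x.
  by rewrite !inE => /or3P[/eqP->|/eqP->|/hs//]; rewrite ?hook_bot ?hook_top.
have bP x : x \in bounded s -> x \in PiT T.
  rewrite !in_setU !in_set1 => /or3P[/eqP->|/eqP->|/sP].
  - exact: part_bot_PiT.
  - exact: part_top_PiT.
  by rewrite inE => /and3P[].
have XE (k : 'I_n.+2) : exists x, x \in bounded s /\ nblocks x = k.+1.
  by have [|x xs xk] := @facet_rank _ _ s k.+1 hP fs; [exact: ltn_ord | exists x].
have [X {XE}XE] := fin_all_exists XE.
have Xb k : X k \in bounded s by case: (XE k).
have XB k : #|last_block (X k)| = (n.+2 - k)%N.
  by have /eqP := hb _ (Xb k); have [_ ->] := XE k; lia.
have Xm (k l : 'I_n.+2) : (k <= l)%N -> last_block (X l) \subset last_block (X k).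
  move=> kl; apply: le_last_block; apply: (bounded_rank_le so) => //.
  by have [_ ->] := XE k; have [_ ->] := XE l.
(* The future value [w k] is the element of the last block of [X k] that is lost in all finer
   members; for the last index it is [ord_max]. *)
have wE (k : 'I_n.+2) : exists i, i \in last_block (X k) /\
    forall l : 'I_n.+2, (k < l)%N -> i \notin last_block (X l).
  have [kn|kn] := ltnP k.+1 n.+2; last first.
    exists ord_max; split=> [|l kl]; first exact: mem_pblock_setpart.
    by have := leq_trans kl (leq_ord l); rewrite ltnNge -ltnS kn.
  have /properP[_ [i ik il]] : last_block (X (Ordinal kn)) \proper last_block (X k).
    by rewrite properEcard Xm //= !XB /=; lia.
  by exists i; split=> // l kl; apply: contra il; apply/subsetP/Xm.
have [f fE] := fin_all_exists wE.
have f_lt (k l : 'I_n.+2) : (k < l)%N -> f k != f l.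
  move=> kl; have [_ /(_ l kl)] := fE k; apply: contraNneq => ->.
  by case: (fE l).
have f_inj : injective f.
  move=> k l fkl; apply/val_inj.
  by case: (ltngtP k l) => // /f_lt; rewrite fkl eqxx.
pose w := perm f_inj.
have wT (k : 'I_n.+2) : perm_tail w k = last_block (X k).
  apply/eqP; rewrite eqEcard card_perm_tail XB leqnn andbT.
  apply/subsetP=> _ /imsetP[j kj ->]; rewrite inE in kj; rewrite permE.
  by apply: (subsetP (Xm _ _ kj)); case: (fE j).
exists w; split.
- have := mem_perm_tail w (ord_max : 'I_n.+2) ord_max; rewrite leqnn (wT ord_max).
  have -> : last_block (X ord_max) = [set ord_max]; last by rewrite inE => /eqP.
  apply/esym/eqP; rewrite eqEcard XB cards1 subSnn leqnn andbT.
  by rewrite sub1set mem_pblock_setpart.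
- have nE : (inord n : 'I_n.+2) = n :> nat by rewrite inordK.
  have := bP _ (Xb (inord n)); rewrite inE -/(last_block _).
  have cB := XB (inord n); rewrite nE in cB.
  case/orP=> [/eqP e|/pred0Pn[i /andP[/= iB iT]]].
    by move: cB; rewrite e cards1; lia.
  rewrite (_ : w (inord n) = i) //; apply: contraTeq iT => iw.
  (* [X (inord n)] has the two-element last block formed by [w (inord n)] and [ord_max]. It meets
     [T], which avoids [ord_max], so [w (inord n)] is in [T]. *)
  have : i \in [set w (inord n); ord_max].
    suff -> : [set w (inord n); ord_max] = last_block (X (inord n)) by [].
    have wm : w (inord n) != ord_max.
      have := mem_perm_tail w (ord_max : 'I_n.+2) (inord n).
      rewrite (wT ord_max) nE ltnn => /negbT; apply: contraNneq => ->.
      exact: mem_pblock_setpart.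
    apply/eqP; rewrite eqEcard cards2 wm cB subUset !sub1set mem_pblock_setpart.
    by rewrite -wT mem_perm_tail leqnn; lia.
  by rewrite !inE eq_sym (negPf iw) => /eqP->.
apply: perm_facet_eq => //; apply/subsetP=> x xs.
have xr := hP x (sP x xs); rewrite inE xr hs //=.
have ltx : ((nblocks x).-1 < n.+2)%N by lia.
rewrite (wT (Ordinal ltx)); apply/eqP; congr last_block.
apply: (bounded_rank_inj so) => //; first by rewrite !inE xs !orbT.
by have [_ ->] := XE (Ordinal ltx); rewrite /= prednK //; lia.
Qed.

End SplittingFacets.

(** * Unit coefficients and the basis *)

(** A generator divisible by its own coefficient [k] on the hook chain forces [k] to be a unit.
    Stated as a square, the result shows [k] to be its own inverse. *)
Lemma fundamental_cycle_unit n (w : 'S_n.+2) (z : schain (setpart n.+2)) :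
    w ord_max = ord_max ->
    fundamental_cycle (n.+2%:Z - 3) (proper_part (Pi_perm w)) z ->
  z (perm_facet w) * z (perm_facet w) = 1.
Proof.
move=> wm; set P := proper_part _; have hP : inner P := @inner_proper_part _ _.
case/(top_homology_basis _ (fun=> inner_schain0 hP)) => /(_ tt) hz B.
set k := z (perm_facet w).
have PsubPi : P \subset Pi_perm w by apply/subsetP=> x; rewrite inE => /and3P[].
have kdvd s : (k %| z s)%Z.
  apply: (dvdz_cycle hP hz) => {}s fs hs.
  by rewrite (hook_facet_Pi_perm wm hP PsubPi fs hs) dvdzz.
have k0 : k != 0.
  apply/eqP => k0; have z0 : z = 0.
    by apply/ffunP=> s; have := kdvd s; rewrite k0 dvd0z ffunE => /eqP.
  (* If [z] were zero, the zero cycle would have several coefficient vectors, such as 0 and 1. *)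
  have [c [_ uc]] := B 0 (rpred0 _).
  have c0 (e : {ffun unit -> int}) : c = e.
    by apply: uc; rewrite big1 // => i _; rewrite z0 mul0rz.
  have := c0 0; rewrite (c0 [ffun=> 1]) => /ffunP/(_ tt).
  by rewrite !ffunE.
pose r : schain (setpart n.+2) := [ffun s => (z s %/ k)%Z].
have hr : r \in is_cycle (n.+2%:Z - 3) P.
  move: (hz); rewrite !inE => /andP[zs /eqP bz]; apply/andP; split.
    apply/forallP=> s; apply/implyP; rewrite ffunE => rs.
    apply: (implyP (forallP zs s)); apply: contraNneq rs => ->.
    by rewrite div0z.
  apply/eqP/ffunP=> t; rewrite [RHS]ffunE; apply: (mulIf k0); rewrite mul0r.
  move/ffunP/(_ t): bz; rewrite [RHS]ffunE => <-; rewrite !ffunE mulr_suml.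
  apply: eq_bigr => s _; rewrite mulr_suml; apply: eq_bigr => x _.
  by rewrite ffunE -mulrA divzK.
(* The quotient [r] is a multiple of [z]; at the hook facet this reads [1 = k * c tt]. *)
have [c [/ffunP/(_ (perm_facet w)) rc _]] := B r hr.
move: rc; rewrite (bigD1 tt) //= big1 ?addr0; last by case.
rewrite ffunMzE ffunE -/k divzz k0 /= mulrzz => /esym ck.
have : (k %| 1)%Z by rewrite -ck dvdz_mulr.
by rewrite dvdz1 => /eqP k1; have [->|->] : k = 1 \/ k = -1 by lia.
Qed.

(* The n of the informal statement, at least 2 since T is nonempty, is n.+2. *)
Theorem theorem9p3 (n : nat) (T : {set 'I_n.+2})
  (T_neq0 : T != set0) (T_sub : T \subset [set i : 'I_n.+2 | i != ord_max])
  (rho : 'S_n.+2 -> schain (setpart n.+2))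
  (rhoP : forall w : 'S_n.+2,
    fundamental_cycle (n.+2%:Z - 3) (proper_part (Pi_perm w)) (rho w)) :
  homology_basis (n.+2%:Z - 3) (proper_part (PiT T))
    (fun w : {w : 'S_n.+2 | (w ord_max == ord_max) && (w (inord n) \in T)} =>
       rho (val w)).
Proof.
have mT : ord_max \notin T.
  by apply/negP=> /(subsetP T_sub); rewrite inE eqxx.
set I := ({w : 'S_n.+2 | _}); set P := proper_part (PiT T).
have hP : inner P := @inner_proper_part _ _.
have wm (w : I) : val w ord_max = ord_max by case: w => w /= /andP[/eqP].
have rho_cycle w : rho w \in is_cycle (n.+2%:Z - 3) (proper_part (Pi_perm w)).
  have hPw := @inner_proper_part _ (Pi_perm w).
  by have [/(_ tt)] := (top_homology_basis _ (fun=> inner_schain0 hPw)).1 (rhoP w).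
have rho_diag (w : I) : rho (val w) (perm_facet (val w)) *
    rho (val w) (perm_facet (val w)) = 1.
  exact: fundamental_cycle_unit (wm w) (rhoP _).
(* A nonzero value puts [perm_facet (val w)] in the proper part of [Pi_perm (val u)], whose only
   hook facet is [perm_facet (val u)]; then [w = u]. *)
have rho_offdiag (w u : I) : u != w -> rho (val u) (perm_facet (val w)) = 0.
  apply: contraNeq => r0; have hPu := @inner_proper_part _ (Pi_perm (val u)).
  have f := cycle_supp (rho_cycle _) r0; apply/eqP/val_inj.
  apply/esym/(perm_facet_inj (wm w) (wm u) hPu f).
  apply: (hook_facet_Pi_perm (wm u) hPu _ f).
    by apply/subsetP=> x; rewrite inE => /and3P[].
  by apply/forall_inP=> x; rewrite inE => /and3P[].
have sumE (c : {ffun I -> int}) (w : I) :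
    (\sum_i rho (val i) *~ c i) (perm_facet (val w)) =
    rho (val w) (perm_facet (val w)) * c w.
  rewrite sum_ffunE (bigD1 w) //= big1 ?addr0 => [|u uw].
    by rewrite ffunMzE mulrzz.
  by rewrite ffunMzE rho_offdiag // mul0rz.
apply/(top_homology_basis _ (fun=> inner_schain0 hP)).
have hz (w : I) : rho (val w) \in is_cycle (n.+2%:Z - 3) P.
  apply: is_cycle_sub (rho_cycle _); apply: proper_part_sub.
  - exact: part_bot_PiT.
  - exact: part_top_PiT.
  by apply: Pi_perm_sub_PiT (wm w) _; case: (w) => w' /= /andP[].
split=> // x hx.
(* Each diagonal entry is its own inverse, so multiplying by it solves the diagonal system. *)
exists [ffun w => rho (val w) (perm_facet (val w)) * x (perm_facet (val w))].
split=> [|c ->]; last first.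
  by apply/ffunP=> w; rewrite ffunE sumE mulrA rho_diag mul1r.
apply/eqP; rewrite -subr_eq0; apply/eqP/ffunP=> s; rewrite [RHS]ffunE.
set y := _ - _; have hy : y \in is_cycle (n.+2%:Z - 3) P.
  by rewrite rpredB // rpred_sum // => w _; rewrite rpredMz.
(* The difference [y] vanishes on hook facets, hence everywhere by the case [k = 0] of
   [dvdz_cycle]. *)
apply/eqP; rewrite -dvd0z; apply: (dvdz_cycle hP hy) => {}s fs hs.
have [w [wmax wT ->]] := hook_facet_PiT T_neq0 mT fs hs.
have wI : (w ord_max == ord_max) && (w (inord n) \in T) by rewrite wmax eqxx.
rewrite dvd0z !ffunE (sumE _ (Sub w wI : I)) ffunE /= mulrA.
by rewrite (rho_diag (Sub w wI : I)) mul1r subrr.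
Qed.
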